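(* Let $F$ be a nondegenerate form, and suppose $F$ is D-nondegenerate. Then $F$ is T-nondegenerate, therefore $\mathfrak g_3=0$.
   Context: $F=(F_1,\dots,F_k)$ is a $\mathbb C^k$-valued Hermitian form on $\mathbb C^m$: $F_j(a,b)=\langle A_ja,b\rangle$, $\langle a,b\rangle=\sum_l a_l\bar b_l$, with $A_1,\dots,A_k$ Hermitian $m\times m$ matrices. $F$ is nondegenerate if (a) $A_1,\dots,A_k$ are linearly independent and (b) $F(z,\zeta)=0$ for all $z\in\mathbb C^m$ implies $\zeta=0$. D-nondegeneracy: for $c\in\mathbb R^k$ such that $A=\sum_{j=1}^kc_jA_j$ is nonsingular and $a\in\mathbb C^m$, let $D=(A_1a,\dots,A_ka)$ (an $m\times k$ matrix with columns $A_ja$) and $B=D^*A^{-1}D$, a $k\times k$ matrix with entries $B_{lj}=\langle A_lA^{-1}A_ja,a\rangle$. $F$ is D-nondegenerate if there exist $c\in\mathbb R^k$ (with $A$ nonsingular) and $a\in\mathbb C^m$ such that the matrix $\operatorname{Re}B:=\frac12(B+\overline B)$ (entrywise real part) is nonsingular. For a set $S\subset\mathbb C^m$ put $S^F=\{x\in\mathbb C^m:\ F(x,y)=0\ \ \forall y\in S\}$. For $a\in\mathbb C^m$ put $T(a)=\{y\in\mathbb C^m:\ \exists x\in\mathbb C^m,\ F(x,a)+F(a,y)=0\}$. A property holds for generic $a\in\mathbb C^m$ if it holds for all $a$ in some open dense subset of $\mathbb C^m$. A nondegenerate form $F$ is T-nondegenerate if $T(a)^F=0$ for generic $a\in\mathbb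 C^m$. With coordinates $z\in\mathbb C^m$, $w=u+iv\in\mathbb C^k$, $\mathfrak g=\sum_{p\ge-2}\mathfrak g_p$ is the graded Lie algebra of infinitesimal CR automorphisms of the quadric $v=F(z,z)$. Giving $z_j,w_j,\partial/\partial z_j,\partial/\partial w_j$ weights $1,2,-1,-2$, $\mathfrak g_p$ is the subspace of weighted homogeneous elements of degree $p$, i.e. the space of vector fields $f\frac{\partial}{\partial z}+g\frac{\partial}{\partial w}$ with $f$ ($\mathbb C^m$-valued) and $g$ ($\mathbb C^k$-valued) weighted homogeneous holomorphic polynomials in $(z,w)$ of weighted degrees $p+1$ and $p+2$ such that $\operatorname{Im}(g-2iF(f,z))|_{w=u+iF(z,z)}=0$ for all $z\in\mathbb C^m$, $u\in\mathbb R^k$. In particular, $\mathfrak g_3$ is the case $p=3$. *)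

(* Defs.v *)
(* MathComp-Analysis supplies the topology of C^m, real-closed the field R[i] and
   multinomials the polynomials; the notations of mpoly clash with those of
   MathComp-Analysis and are not imported. *)
From HB Require Import structures.
From mathcomp Require Import all_boot all_order all_algebra.
From mathcomp Require Import complex.
From mathcomp Require Import -(notations) mpoly.
From mathcomp Require Import all_classical all_reals all_analysis.
Set Implicit Arguments.
Unset Strict Implicit.
Unset Printing Implicit Defensive.
Import Order.TTheory GRing.Theory Num.Theory.
Import numFieldNormedType.Exports.
Local Open Scope classical_set_scope.
Local Open Scope ring_scope.

(* R[i], typed as a numClosedFieldType so that matrices over it receive the
   topology that MathComp-Analysis puts on numeric fields, i.e. the one given
   by the complex modulus. *)
Definition Cplx (R : realType) : numClosedFieldType := R[i].

Definition ofreal (R : realType) (x : R) : Cplx R := real_complex R x.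

Section HermitianForms.
Variables (R : realType) (m k : nat).
Local Notation C := (Cplx R).

Definition hdot (a b : 'cV[C]_m) : C := \sum_(l < m) a l 0 * (b l 0)^*.

Variable A : 'I_k -> 'M[C]_m.

(* Linear in the first argument, conjugate-linear in the second. *)
Definition formF (a b : 'cV[C]_m) : 'cV[C]_k := \col_(j < k) hdot (A j *m a) b.

Definition hermitian_form : Prop := forall j, A j \is hermsymmx.

Definition nondegenerate_form : Prop :=
  free [tuple A j | j < k] /\
  (forall zeta : 'cV[C]_m, (forall z, formF z zeta = 0) -> zeta = 0).

Definition comb (c : 'cV[R]_k) : 'M[C]_m := \sum_(j < k) ofreal (c j 0) *: A j.

Definition Dmx (a : 'cV[C]_m) : 'M[C]_(m, k) :=
  \matrix_(l < m, j < k) (A j *m a) l 0.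

Definition Bmx (c : 'cV[R]_k) (a : 'cV[C]_m) : 'M[C]_k :=
  (map_mx Num.conj (Dmx a)^T) *m invmx (comb c) *m Dmx a.

Definition Re_mx (B : 'M[C]_k) : 'M[C]_k := 2^-1 *: (B + map_mx Num.conj B).

Definition Dnondegenerate : Prop :=
  exists (c : 'cV[R]_k) (a : 'cV[C]_m),
    comb c \in unitmx /\ Re_mx (Bmx c a) \in unitmx.

Definition orthF (S : set 'cV[C]_m) : set 'cV[C]_m :=
  [set x | forall y, S y -> formF x y = 0].

Definition Tset (a : 'cV[C]_m) : set 'cV[C]_m :=
  [set y | exists x, formF x a + formF a y = 0].

Definition generic (P : 'cV[C]_m -> Prop) : Prop :=
  exists U : set 'cV[C]_m, [/\ open U, dense U & forall a, U a -> P a].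

Definition Tnondegenerate : Prop :=
  nondegenerate_form /\ generic (fun a => orthF (Tset a) = [set 0]).

(* Polynomials in (z, w): the first m variables are the z_l (weight 1), the
   last k are the w_j (weight 2). *)
Local Notation poly_zw := (mpoly (m + k) C).

Definition monomial_weight (mon : multinom (m + k)) : nat :=
  (\sum_(l < m) mon (lshift k l) + \sum_(j < k) 2 * mon (rshift m j))%N.

(* The zero polynomial is homogeneous of every degree, and the only one that is
   homogeneous of a negative degree; degrees are integers because f has degree
   p + 1 = -1 when p = -2. *)
Definition weighted_homogeneous (d : int) (q : poly_zw) : Prop :=
  forall mon, mon \in msupp q -> (monomial_weight mon)%:Z = d.

Definition eval_zw n (q : 'cV[poly_zw]_n) (z : 'cV[C]_m) (w : 'cV[C]_k) :
    'cV[C]_n :=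
  \col_(i < n) meval (fun s => col_mx z w s 0) (q i 0).

(* The graded component of degree p; the pair (f, g) stands for the vector
   field f d/dz + g d/dw. *)
Definition g_ (p : int) : set ('cV[poly_zw]_m * 'cV[poly_zw]_k) :=
  [set fg : 'cV[poly_zw]_m * 'cV[poly_zw]_k |
    [/\ forall l, weighted_homogeneous (p + 1) (fg.1 l 0),
        forall j, weighted_homogeneous (p + 2) (fg.2 j 0) &
        forall (z : 'cV[C]_m) (u : 'cV[R]_k) (j : 'I_k),
          let w : 'cV[C]_k := map_mx (@ofreal R) u + 'i *: formF z z in
          let f := eval_zw fg.1 z w in
          let g := eval_zw fg.2 z w in
          'Im ((g - (2 * 'i) *: formF f z) j 0) = 0]].

End HermitianForms.

(* Main.v *)
Require Import Defs.
From HB Require Import structures.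
From mathcomp Require Import all_boot all_order all_algebra.
From mathcomp Require Import complex.
From mathcomp Require Import -(notations) mpoly.
From mathcomp Require Import all_classical all_reals all_analysis.
From mathcomp Require Import ring.
Set Implicit Arguments.
Unset Strict Implicit.
Unset Printing Implicit Defensive.
Import Order.TTheory GRing.Theory Num.Theory.
Import numFieldNormedType.Exports.
Local Open Scope ring_scope.

(** Fix [c] with [A = sum_j c_j A_j] nonsingular, and write [F] for the form,
    [G = sum_j c_j F_j] for the scalar form of [A], [D] for the matrix with
    columns [A_j a], and [d_j = A^-1 A_j a].  These vectors satisfy
    [G(d_j, y) = F_j(a, y)] for all [y], and [B_ij = F_i(d_j, a)].  Everything
    happens at the good points [a], where [Re B] is nonsingular.  As
    [det (Re B)] is a polynomial in [a] and its conjugate, the good points form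
    an open set which is dense as soon as there is one
    ([open_realpoly_neq0], [dense_realpoly_neq0]); for the same reason, a
    polynomial identity proved at the good points holds everywhere
    ([realpoly_eq0]).

    T-nondegeneracy ([orthF_Tset_eq0]).  By duality, a vector is orthogonal to
    [T(a)] exactly when it is [D conj(v)] with [D v = 0].  So if [z] lies in
    [T(a)^F], then [A_j z = D conj(v_j)] with [D v_j = 0].  Pairing with [a],
    where [F(a,a)] is real, gives [F(z,a) = 0]; combining with the weights [c]
    gives [A z = D conj(v)] with [D v = 0].  Hence [B conj(v) = F(z,a) = 0] and
    [conj(B) conj(v) = conj(B v) = 0], so [Re B] kills [conj(v)]: at a good
    point [v = 0], and then [z = 0].

    Weight three.  Regarding [z] and its conjugate as independent turns the
    tangency condition into an identity between a point and a second,
    independent point [zeta] ([segre_identity]).  Write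
    [f = phi4(z) + phi2(z) w + beta(w, w)], the decomposition by degree in [w].
    Setting [zeta = 0] expresses [g] through [beta], and comparing the degrees
    in [z] leaves ([weight3_equations])
      [phi4 = 0],   [F(phi2(z) F(z,zeta), zeta) = 0],
      [F(phi2(z) v, zeta) = 4i F(z, beta(conj v, F(zeta,z)))].
    The last equation shows that [phi2] vanishes with [beta], and all is
    reduced to [beta = 0].

    For fixed [u], the antilinear functional [L(w) = G(a, beta(u, w))] is zero
    at a good point once it vanishes on the vectors [F(d_j,a) + F(a,d_j)],
    because these are the columns of [2 Re B].  The last equation, used twice,
    computes [L(F(d_j,a)) = F_j(a, beta(u, F(a,a)))] ([combF_b_eq0]).  The
    opposite value at [F(a,d_j)] comes from polarization, in two rounds.  For
    [u = F(a,a)] both values are [0], by polarizing the identity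
    [F(z, beta(F(zeta,z), F(zeta,z))) = 0] implied by the last two equations
    ([combF_b_diag]).  Thus [G(a, beta(F(a,a), w)) = 0] at the good [a], hence
    for all [a], and polarizing this in [a] gives what is needed for every [u]
    ([combF_b]).  So [G(a, beta(u, w)) = 0] for all [a], and [beta = 0] since
    [A] is nonsingular. *)

(** * Polynomials determined by their values *)

Lemma poly_eq0_infinite (F : fieldType) (p : {poly F}) (s : nat -> F) :
  injective s -> (forall n, p.[s n] = 0) -> p = 0.
Proof.
move=> s_inj ps0; apply/eqP/negPn/negP => p_neq0.
suff: (size [seq s n | n <- iota 0 (size p)] < size p)%N.
  by rewrite size_map size_iota ltnn.
apply: max_poly_roots => //; last by rewrite (map_inj_uniq s_inj) iota_uniq.
by apply/allP => _ /mapP[n _ ->]; apply/rootP.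
Qed.

Lemma natr_inj (K : numFieldType) : injective (fun n => n%:R : K).
Proof. by move=> i j /eqP; rewrite eqr_nat => /eqP. Qed.

Lemma choice2 (X Y : Type) (P Q : X -> Y -> Prop) :
    (forall x, exists2 y, P x y & Q x y) ->
  exists2 f, (forall x, P x (f x)) & (forall x, Q x (f x)).
Proof.
move=> PQ.
have /choice[f fPQ] x : exists y, P x y /\ Q x y by have [y] := PQ x; exists y.
by exists f => x; have [] := fPQ x.
Qed.

(** Serves to compare coefficients in identities that hold along real lines,
    where a form and its arguments scale without conjugates. *)
Lemma poly4_eq0 (K : numFieldType) (c0 c1 c2 c3 c4 : K) :
  (forall n : nat, c0 + c1 * n%:R + c2 * n%:R ^+ 2 + c3 * n%:R ^+ 3
                   + c4 * n%:R ^+ 4 = 0) ->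
  [/\ c0 = 0, c1 = 0, c2 = 0, c3 = 0 & c4 = 0].
Proof.
move=> c_eq0; have p0 : Poly [:: c0; c1; c2; c3; c4] = 0.
  apply: (poly_eq0_infinite (@natr_inj K)) => n.
  by rewrite -(c_eq0 n) horner_Poly /=; ring.
have cE i : [:: c0; c1; c2; c3; c4]`_i = 0 by rewrite -coef_Poly p0 coef0.
by split; [exact: (cE 0%N)|exact: (cE 1%N)|exact: (cE 2%N)|exact: (cE 3%N)|
  exact: (cE 4%N)].
Qed.

Section Mpoly.
Variables (K : numFieldType) (n : nat).
Implicit Types (q : mpoly n K) (v : 'I_n -> K) (mon : multinom n).

(** Scaling one variable at a time by a natural number separates the monomials
    by their exponent in that variable; once this is done for all variables,
    only one monomial is left. *)
Lemma mpoly_eq0_meval q : (forall v, meval v q = 0) -> q = 0.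
Proof.
move=> q0; apply/mpolyP => e; rewrite mcoeff0.
have [eq|] := boolP (e \in msupp q); last by rewrite -mcoeff_eq0 => /eqP.
suff /(_ (enum 'I_n) (fun=> 1)): forall (s : seq 'I_n) v,
    \sum_(mon <- msupp q | all (fun i => mon i == e i) s)
      mcoeff mon q * \prod_i v i ^+ mon i = 0.
  (* The case of the full list of variables, evaluated at (1, ..., 1). *)
  rewrite big_mkcond (bigD1_seq e) ?msupp_uniq //=.
  have -> : all (fun i => e i == e i) (enum 'I_n) by apply/allP => i _.
  rewrite big1 ?mulr1 => [|i _]; last exact: expr1n.
  rewrite big1 ?addr0 // => mon ne_mon; case: ifP => // /allP eq_mon.
  case/eqP: ne_mon; apply/mnmP => i; apply/eqP/eq_mon.
  by rewrite mem_enum.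
elim=> [v|i s IHs v]; first by rewrite -mevalE q0.
pose p : {poly K} := \sum_(mon <- msupp q | all (fun i => mon i == e i) s)
   (mcoeff mon q * \prod_j v j ^+ mon j) *: 'X^(mon i).
have p0 : p = 0.
  apply: (poly_eq0_infinite (@natr_inj K)) => t.
  rewrite horner_sum.
  apply: etrans (IHs (fun j => v j * (if j == i then t%:R else 1))).
  apply: eq_bigr => mon _; rewrite hornerZ hornerXn -mulrA; congr (_ * _).
  under [RHS]eq_bigr do rewrite exprMn.
  rewrite big_split /=; congr (_ * _).
  by rewrite (bigD1 i) //= eqxx big1 ?mulr1 // => j /negPf->; rewrite expr1n.
have := congr1 (fun p : {poly K} => p`_(e i)) p0.
rewrite /p coef_sum coef0 => p_e; apply: etrans p_e.
rewrite [LHS]big_mkcond [RHS]big_mkcond.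
apply: eq_bigr => mon _ /=; rewrite coefZ coefXn eq_sym.
by case: (all _ s); case: eqP; rewrite ?mulr1 ?mulr0.
Qed.

End Mpoly.

(** * Weighted homogeneous polynomials *)

Section Weights.
Variables (K : numFieldType) (n : nat).
Implicit Types (q : mpoly n K) (v : 'I_n -> K) (mon : multinom n).
Variable wt : 'I_n -> nat.

Definition wdeg mon := (\sum_s wt s * mon s)%N.

Definition whomog d q := forall mon, mon \in msupp q -> wdeg mon = d.

Lemma whomog_mderiv d q s :
  whomog (wt s + d) q -> whomog d (mderiv s q).
Proof.
move=> hq mon; rewrite mcoeff_msupp mcoeff_deriv => nz.
have /hq : mnm_add mon (mnm1 s) \in msupp q.
  by rewrite mcoeff_msupp; apply: contraNN nz => /eqP->; rewrite mul0rn.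
rewrite /wdeg; under eq_bigr do rewrite mnmDE mnm1E mulnDr.
rewrite big_split /= [X in (_ + X)%N](bigD1 s) //= eqxx muln1.
rewrite [X in (_ + (_ + X))%N]big1.
  by rewrite addn0 addnC => /addnI.
by move=> i; rewrite eq_sym => /negPf->; rewrite muln0.
Qed.

(** Euler's identity for quasi-homogeneous polynomials.  It writes a polynomial
    of positive weight through polynomials of smaller weight, which is how the
    evaluations below are obtained. *)
Lemma whomog_euler d q v : whomog d q ->
  \sum_s (wt s)%:R * (v s * meval v (mderiv s q)) = d%:R * meval v q.
Proof.
move=> hq.
have evalD s : v s * meval v (mderiv s q) =
    \sum_(mon <- msupp q) mcoeff mon q * ((mon s)%:R * \prod_i v i ^+ mon i).
  rewrite {1}[q]mpolyE (raddf_sum (mderiv s)) (raddf_sum (meval v)) mulr_sumr.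
  apply: eq_bigr => mon _ /=.
  rewrite mderivZ mevalZ mderivX mevalZ mevalX mulrCA; congr (_ * _).
  have [->|mon_s] := posnP (mon s); first by rewrite !mul0r mulr0.
  rewrite mulrCA; congr (_ * _).
  rewrite (bigD1 s) //= [RHS](bigD1 s) //= mulrA.
  congr (_ * _); last first.
    apply: eq_bigr => i; rewrite mnmBE mnm1E eq_sym => /negPf->.
    by rewrite subn0.
  by rewrite mnmBE mnm1E eqxx subn1 -exprS prednK.
under eq_bigr do rewrite evalD mulr_sumr.
rewrite exchange_big mevalE mulr_sumr; apply: eq_big_seq => mon /hq <- /=.
rewrite /wdeg natr_sum mulr_suml; apply: eq_bigr => s _.
by rewrite natrM; ring.
Qed.

Lemma whomog_scale d q v t :
  whomog d q ->
  meval (fun s => t ^+ wt s * v s) q = t ^+ d * meval v q.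
Proof.
move=> hq; rewrite !mevalE mulr_sumr; apply: eq_big_seq => mon /hq <-.
rewrite mulrCA; congr (_ * _); rewrite expr_sum -big_split.
by apply: eq_bigr => s _; rewrite exprMn exprM.
Qed.

End Weights.

Section MpolyZW.
Variables (K : numFieldType) (m k : nat).
Implicit Types (q : mpoly (m + k) K) (z : 'cV[K]_m) (w : 'cV[K]_k).

Definition wt_zw (s : 'I_(m + k)) : nat :=
  if fintype.split s is inl _ then 1 else 2.

Local Notation whomog := (whomog wt_zw).
Local Notation ev q z w := (meval (fun s => col_mx z w s 0) q).
Local Notation dz l q := (mderiv (lshift k l) q).
Local Notation dw j q := (mderiv (rshift m j) q).

Lemma wt_lshift l : wt_zw (lshift k l) = 1%N.
Proof. by rewrite /wt_zw -[lshift k l]/(unsplit (inl l)) unsplitK. Qed.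

Lemma wt_rshift j : wt_zw (rshift m j) = 2%N.
Proof. by rewrite /wt_zw -[rshift m j]/(unsplit (inr j)) unsplitK. Qed.

Lemma whomog_dz d q l : whomog d.+1 q -> whomog d (dz l q).
Proof. by move=> hq; apply: whomog_mderiv; rewrite wt_lshift. Qed.

Lemma whomog_dw d q j : whomog d.+2 q -> whomog d (dw j q).
Proof. by move=> hq; apply: whomog_mderiv; rewrite wt_rshift. Qed.

Lemma euler_zw d q z w : whomog d q ->
  d%:R * ev q z w = \sum_l z l 0 * ev (dz l q) z w +
                    2 * \sum_j w j 0 * ev (dw j q) z w.
Proof.
move=> /whomog_euler <-; rewrite big_split_ord mulr_sumr; congr (_ + _).
  by apply: eq_bigr => l _; rewrite wt_lshift mul1r col_mxEu.
by apply: eq_bigr => j _; rewrite wt_rshift col_mxEd.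
Qed.

Lemma whomog0_eval q : whomog 0 q -> exists c, forall z w, ev q z w = c.
Proof.
move=> hq; exists (\sum_(mon <- msupp q) mcoeff mon q) => z w; rewrite mevalE.
apply: eq_big_seq => mon /hq /eqP; rewrite sum_nat_eq0 => /forallP mon0.
rewrite big1 ?mulr1 // => s _; have /= := mon0 s.
rewrite muln_eq0 /wt_zw.
by case: (fintype.split s) => _ /= /eqP->; rewrite expr0.
Qed.

Lemma whomog1_eval q : whomog 1 q ->
  exists c : 'I_m -> K, forall z w, ev q z w = \sum_l z l 0 * c l.
Proof.
move=> hq.
have /choice[c cE] l := whomog0_eval (whomog_dz (l := l) hq).
exists c => z w; rewrite -[LHS]mul1r (euler_zw _ _ hq).
rewrite [X in _ + _ * X]big1 => [|j _].
  by rewrite mulr0 addr0; apply: eq_bigr => l _; rewrite cE.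
(* A monomial of weight 1 contains no w. *)
suff -> : dw j q = 0 by rewrite meval0 mulr0.
apply/mpolyP => mon; rewrite mcoeff_deriv mcoeff0.
have [/hq|] := boolP (mnm_add mon (mnm1 (rshift m j)) \in msupp q); last first.
  by rewrite -mcoeff_eq0 => /eqP->; rewrite mul0rn.
rewrite /wdeg (bigD1 (rshift m j)) //= wt_rshift mnmDE mnm1E eqxx.
by rewrite addn1 mulnS.
Qed.

Lemma whomog2_eval q : whomog 2 q ->
  exists2 phi : 'cV[K]_m -> K, (forall t z, phi (t *: z) = t ^+ 2 * phi z) &
  exists c : 'I_k -> K, forall z w, ev q z w = phi z + \sum_j w j 0 * c j.
Proof.
move=> hq.
have /choice[p pE] l := whomog1_eval (whomog_dz (l := l) hq).
have /choice[c cE] j := whomog0_eval (whomog_dw (j := j) hq).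
exists (fun z => 2^-1 * \sum_l z l 0 * \sum_i z i 0 * p l i).
  move=> t z; rewrite mulrCA; congr (_ * _); rewrite mulr_sumr.
  apply: eq_bigr => l _; rewrite mxE expr2 -!mulrA; congr (_ * _).
  rewrite mulrCA; congr (_ * _); rewrite mulr_sumr.
  by apply: eq_bigr => i _; rewrite mxE mulrA.
exists c => z w; apply: (@mulfI _ 2); first by rewrite pnatr_eq0.
rewrite (euler_zw _ _ hq) mulrDr mulVKf ?pnatr_eq0 //; congr (_ + 2 * _).
  by apply: eq_bigr => l _; rewrite pE.
by apply: eq_bigr => j _; rewrite cE.
Qed.

Lemma whomog3_eval q : whomog 3 q ->
  exists2 phi : 'cV[K]_m -> K, (forall t z, phi (t *: z) = t ^+ 3 * phi z) &
  exists2 psi : 'I_k -> 'cV[K]_m -> K,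
    (forall j t z, psi j (t *: z) = t * psi j z) &
    forall z w, ev q z w = phi z + \sum_j w j 0 * psi j z.
Proof.
move=> hq.
have /choice2[p pZ /choice[c pE]] l := whomog2_eval (whomog_dz (l := l) hq).
have /choice[r rE] j := whomog1_eval (whomog_dw (j := j) hq).
exists (fun z => 3^-1 * \sum_l z l 0 * p l z).
  move=> t z; rewrite mulrCA; congr (_ * _); rewrite mulr_sumr.
  by apply: eq_bigr => l _; rewrite mxE pZ; ring.
exists (fun j z => 3^-1 * \sum_l z l 0 * (c l j + 2 * r j l)).
  move=> j t z; rewrite mulrCA; congr (_ * _); rewrite mulr_sumr.
  by apply: eq_bigr => l _; rewrite mxE; ring.
move=> z w; apply: (@mulfI _ 3); first by rewrite pnatr_eq0.
rewrite (euler_zw _ _ hq) mulrDr mulVKf ?pnatr_eq0 //.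
under [X in _ = _ + 3 * X]eq_bigr do rewrite mulrCA.
rewrite -mulr_sumr mulVKf ?pnatr_eq0 //.
under eq_bigr do rewrite pE mulrDr.
under [X in _ + 2 * X]eq_bigr do rewrite rE.
rewrite big_split /= -addrA; congr (_ + _).
under eq_bigr do rewrite mulr_sumr.
rewrite exchange_big mulr_sumr -big_split; apply: eq_bigr => j _ /=.
rewrite !mulr_sumr -big_split; apply: eq_bigr => l _ /=.
by ring.
Qed.

(** In weight 4 the degree in [w] is at most 2; the successive applications of
    Euler's identity sort the terms by that degree and keep track of their
    homogeneity in [z]. *)
Lemma whomog4_eval q : whomog 4 q ->
  exists2 phi : 'cV[K]_m -> K, (forall t z, phi (t *: z) = t ^+ 4 * phi z) &
  exists2 psi : 'I_k -> 'cV[K]_m -> K,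
    (forall j t z, psi j (t *: z) = t ^+ 2 * psi j z) &
  exists S : 'I_k -> 'I_k -> K,
    forall z w, ev q z w =
      phi z + \sum_j w j 0 * psi j z + \sum_i \sum_j S i j * (w i 0 * w j 0).
Proof.
move=> hq.
have /choice2[p pZ /choice2[r rZ pE]] l := whomog3_eval (whomog_dz (l := l) hq).
have /choice2[s sZ /choice[c sE]] j := whomog2_eval (whomog_dw (j := j) hq).
exists (fun z => 4^-1 * \sum_l z l 0 * p l z).
  move=> t z; rewrite mulrCA; congr (_ * _); rewrite mulr_sumr.
  by apply: eq_bigr => l _; rewrite mxE pZ; ring.
exists (fun j z => 4^-1 * (\sum_l z l 0 * r l j z + 2 * s j z)).
  move=> j t z; rewrite mulrCA; congr (_ * _); rewrite mulrDr mulr_sumr sZ.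
  congr (_ + _); last by ring.
  by apply: eq_bigr => l _; rewrite mxE rZ; ring.
exists (fun i j => 4^-1 * (2 * c i j)) => z w.
apply: (@mulfI _ 4); first by rewrite pnatr_eq0.
rewrite (euler_zw _ _ hq) !mulrDr mulVKf ?pnatr_eq0 //.
under [X in _ = _ + 4 * X + _]eq_bigr do rewrite mulrCA.
rewrite -mulr_sumr mulVKf ?pnatr_eq0 //.
under eq_bigr do rewrite pE mulrDr.
under [X in _ + 2 * X]eq_bigr do rewrite sE mulrDr.
rewrite !big_split /= -!addrA; congr (_ + _).
rewrite mulrDr addrA; congr (_ + _).
  under eq_bigr do rewrite mulr_sumr.
  rewrite exchange_big mulr_sumr -big_split; apply: eq_bigr => j _ /=.
  rewrite !mulrDr mulr_sumr; congr (_ + _); last by ring.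
  by apply: eq_bigr => l _; ring.
rewrite !mulr_sumr; apply: eq_bigr => i _; rewrite !mulr_sumr.
by apply: eq_bigr => j _; field.
Qed.

End MpolyZW.

Definition symmetric_bilinear (K : numFieldType) m k
    (beta : 'cV[K]_k -> 'cV[K]_k -> 'cV[K]_m) :=
  [/\ forall u v w, beta u (v + w) = beta u v + beta u w,
      forall t u v, beta u (t *: v) = t *: beta u v &
      forall u v, beta u v = beta v u].

Section Weight4.
Variables (C : numClosedFieldType) (m k : nat).

Lemma weight4_structure n (q : 'cV[mpoly (m + k) C]_n) :
  (forall l, whomog (@wt_zw m k) 4 (q l 0)) ->
  exists phi4 : 'cV[C]_m -> 'cV[C]_n,
  exists2 phi2 : 'cV[C]_m -> 'cV[C]_k -> 'cV[C]_n,
    [/\ forall t z, phi4 (t *: z) = t ^+ 4 *: phi4 z,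
        forall t z w, phi2 (t *: z) w = t ^+ 2 *: phi2 z w,
        forall z v w, phi2 z (v + w) = phi2 z v + phi2 z w &
        forall t z w, phi2 z (t *: w) = t *: phi2 z w] &
  exists2 beta : 'cV[C]_k -> 'cV[C]_k -> 'cV[C]_n,
    symmetric_bilinear beta &
    forall z w, (\col_l meval (fun s => col_mx z w s 0) (q l 0)) =
      phi4 z + phi2 z w + beta w w.
Proof.
move=> hq.
have /choice2[p4 p4Z /choice2[p2 p2Z /choice[S qE]]] l := whomog4_eval (hq l).
exists (fun z => \col_l p4 l z).
exists (fun z w => \col_l \sum_j w j 0 * p2 l j z).
  split=> [t z|t z w|z v w|t z w]; apply/colP => l; rewrite !mxE ?p4Z //.
  - by rewrite mulr_sumr; apply: eq_bigr => j _; rewrite p2Z mulrCA.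
  - by rewrite -big_split; apply: eq_bigr => j _; rewrite mxE mulrDl.
  - by rewrite mulr_sumr; apply: eq_bigr => j _; rewrite mxE mulrA.
exists (fun u v => \col_l (2^-1 * \sum_i \sum_j
   S l i j * (u i 0 * v j 0 + u j 0 * v i 0))).
  split=> [u v w|t u v|u v]; apply/colP => l; rewrite !mxE.
  - rewrite -mulrDr -big_split; congr (_ * _); apply: eq_bigr => i _.
    by rewrite -big_split; apply: eq_bigr => j _; rewrite !mxE /=; ring.
  - rewrite mulrCA; congr (_ * _); rewrite mulr_sumr; apply: eq_bigr => i _.
    by rewrite mulr_sumr; apply: eq_bigr => j _; rewrite !mxE; ring.
  - congr (_ * _); apply: eq_bigr => i _; apply: eq_bigr => j _.
    by congr (_ * _); ring.
move=> z w; apply/colP => l; rewrite !mxE.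
rewrite qE; congr (_ + _); rewrite mulr_sumr; apply: eq_bigr => i _.
by rewrite mulr_sumr; apply: eq_bigr => j _; field.
Qed.

(** A polynomial in [w] alone has even weight.  Here this is seen by flipping
    the sign of [z], which fixes the points with [z = 0]. *)
Lemma whomog_odd_eval0 d (q : mpoly (m + k) C) (w : 'cV[C]_k) :
  odd d -> whomog (@wt_zw m k) d q ->
  meval (fun s => col_mx (0 : 'cV_m) w s 0) q = 0.
Proof.
move=> odd_d hq.
have := whomog_scale (fun s => col_mx (0 : 'cV_m) w s 0) (-1) hq.
rewrite -signr_odd odd_d expr1 mulN1r => gN.
suff E : meval (fun s => (-1) ^+ wt_zw s * col_mx (0 : 'cV_m) w s 0) q
    = meval (fun s => col_mx (0 : 'cV_m) w s 0) q.
  by move/eqP: gN; rewrite E eq_sym eqNr => /eqP.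
apply: meval_eq => s; case: (split_ordP s) => i ->.
  by rewrite col_mxEu mxE mulr0.
by rewrite wt_rshift sqrrN expr1n mul1r.
Qed.

End Weight4.

Lemma weighted_homogeneousP (R : realType) (m k d : nat)
    (q : mpoly (m + k) (Cplx R)) :
  weighted_homogeneous d%:Z q -> whomog (@wt_zw m k) d q.
Proof.
move=> hq mon /hq [<-]; rewrite /wdeg big_split_ord; congr (_ + _)%N.
  by apply: eq_bigr => l _; rewrite wt_lshift mul1n.
by apply: eq_bigr => j _; rewrite wt_rshift.
Qed.

(** * Polynomials in a vector and its conjugate *)

Section RealPolynomials.
Local Open Scope classical_set_scope.
Variables (C : numClosedFieldType) (m : nat).

(** The polynomials in the coordinates of a vector and their conjugates, as
    functions.  The inductive form lets continuity and the behaviour on lines be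
    proved by structural induction. *)
Inductive realpoly : ('cV[C]_m -> C) -> Prop :=
| realpoly_cst c : realpoly (fun=> c)
| realpoly_coord l : realpoly (fun a => a l 0)
| realpolyD f g : realpoly f -> realpoly g -> realpoly (fun a => f a + g a)
| realpolyM f g : realpoly f -> realpoly g -> realpoly (fun a => f a * g a)
| realpoly_conj f : realpoly f -> realpoly (fun a => (f a)^*).

Lemma eq_realpoly f g : f =1 g -> realpoly f -> realpoly g.
Proof. by move=> /funext->. Qed.

Lemma realpoly_sum (I : Type) (r : seq I) (f : I -> 'cV[C]_m -> C) :
  (forall i, realpoly (f i)) -> realpoly (fun a => \sum_(i <- r) f i a).
Proof.
move=> pf; elim: r => [|i r IHr].
  by apply: eq_realpoly (realpoly_cst 0) => a; rewrite big_nil.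
by apply: eq_realpoly (realpolyD (pf i) IHr) => a; rewrite big_cons.
Qed.

Lemma realpoly_prod (I : Type) (r : seq I) (f : I -> 'cV[C]_m -> C) :
  (forall i, realpoly (f i)) -> realpoly (fun a => \prod_(i <- r) f i a).
Proof.
move=> pf; elim: r => [|i r IHr].
  by apply: eq_realpoly (realpoly_cst 1) => a; rewrite big_nil.
by apply: eq_realpoly (realpolyM (pf i) IHr) => a; rewrite big_cons.
Qed.

Lemma realpoly_det n (M : 'cV[C]_m -> 'M[C]_n) :
  (forall i j, realpoly (fun a => M a i j)) -> realpoly (fun a => \det (M a)).
Proof.
move=> pM; apply: realpoly_sum => s.
apply: realpolyM; first exact: realpoly_cst.
by apply: realpoly_prod.
Qed.

Lemma realpoly_continuous f : realpoly f -> continuous f.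
Proof.
elim=> {f} [c|l|f g _ cf _ cg|f g _ cf _ cg|f _ cf] a.
- exact: cst_continuous.
- exact: coord_continuous.
- by apply: continuousD; [exact: cf|exact: cg].
- by apply: continuousM; [exact: cf|exact: cg].
apply: (@continuous_comp _ _ _ f Num.conj); first exact: cf.
move=> U /nbhs_ballP[e e0 eU]; apply/nbhs_ballP; exists e => // y.
rewrite -ball_normE /= => ye; apply: eU.
by rewrite -ball_normE /= -rmorphB norm_conjC.
Qed.

(** Conjugation is invisible at real parameters, so that on a real line such a
    function is an ordinary polynomial. *)
Lemma realpoly_line f a d : realpoly f ->
  exists p : {poly C}, forall t, t^* = t -> f (a + t *: d) = p.[t].
Proof.
elim=> {f} [c|l|f g _ [p pE] _ [q qE]|f g _ [p pE] _ [q qE]|f _ [p pE]].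
- by exists c%:P => t _; rewrite hornerC.
- by exists ((a l 0)%:P + (d l 0) *: 'X) => t _; rewrite !mxE !hornerE mulrC.
- by exists (p + q) => t tR; rewrite hornerD pE ?qE.
- by exists (p * q) => t tR; rewrite hornerM pE ?qE.
exists (map_poly Num.conj p) => t tR.
by rewrite pE // -{2}tR horner_map.
Qed.

Lemma open_realpoly_neq0 f : realpoly f -> open [set a | f a != 0].
Proof.
move=> pf.
have -> : [set a | f a != 0] = f @^-1` [set y | y != 0] by [].
apply: open_comp; first by move=> a _; apply: realpoly_continuous.
rewrite openE => y /= y0; apply/nbhs_ballP.
exists `|y|; first by rewrite /= normr_gt0.
move=> x; rewrite -ball_normE /=; apply: contraTneq => ->.
by rewrite subr0 ltxx.
Qed.

(** On the real line through a given point and a point where the function does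
    not vanish, the function is a nonzero polynomial, with finitely many zeros,
    while a given neighbourhood contains infinitely many points of the line. *)
Lemma dense_realpoly_neq0 f a0 :
  realpoly f -> f a0 != 0 -> dense [set a | f a != 0].
Proof.
move=> pf fa0 O [a Oa] openO.
have [p pE] := realpoly_line a (a0 - a) pf.
have p_neq0 : p != 0.
  apply: contraNneq fa0 => p0; have := pE 1 (conjC1 _).
  by rewrite p0 horner0 scale1r addrC subrK => ->.
have /nbhs_ballP[e /= e0 eO] : nbhs a O by apply: open_nbhs_nbhs.
(* Dividing by M keeps all the parameters s n below inside the ball. *)
pose M := 1 + \sum_l `|(a0 - a) l 0|.
have M_gt0 : 0 < M by rewrite ltr_pwDl ?ltr01 // sumr_ge0.
have eM_gt0 : 0 < e / M by rewrite divr_gt0.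
pose s n : C := e / M / n.+1%:R.
have s_gt0 n : 0 < s n by rewrite divr_gt0 ?ltr0n.
have s_real n : (s n)^* = s n by apply/conj_Creal/gtr0_real.
have s_inj : injective s.
  move=> i j /(mulfI (lt0r_neq0 eM_gt0))/invr_inj/eqP.
  by rewrite eqr_nat => /eqP[].
have sO n : O (a + s n *: (a0 - a)).
  apply: eO; split=> // l i; rewrite ord1 -ball_normE /= [X in _ - X]mxE.
  rewrite opprD addrA subrr sub0r normrN [X in `|X|]mxE normrM gtr0_norm //.
  rewrite -[ltRHS](divfK (lt0r_neq0 M_gt0)).
  apply: (@le_lt_trans _ _ (e / M * `|(a0 - a) l 0|)).
    by rewrite ler_wpM2r // ler_pdivrMr ?ltr0n // ler_peMr ?ler1n // ltW.
  rewrite ltr_pM2l // /M (bigD1 l) //=.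
  by rewrite addrCA ltr_pwDr // ltr_pwDl ?ltr01 // sumr_ge0.
apply: contrapT => OS; case/eqP: p_neq0.
apply: (poly_eq0_infinite s_inj) => n; rewrite -pE //.
apply/eqP/negPn/negP => fs; apply: OS.
by exists (a + s n *: (a0 - a)).
Qed.

(** On a line through a point where [f] does not vanish, [f * g] is the zero
    polynomial and [f] is not, so [g] is. *)
Lemma realpoly_eq0 f g a0 : realpoly f -> realpoly g -> f a0 != 0 ->
  (forall a, f a != 0 -> g a = 0) -> forall a, g a = 0.
Proof.
move=> pf pg fa0 fg a.
have [p pE] := realpoly_line a (a0 - a) pf.
have [q qE] := realpoly_line a (a0 - a) pg.
have p_neq0 : p != 0.
  apply: contraNneq fa0 => p0; have := pE 1 (conjC1 _).
  by rewrite p0 horner0 scale1r addrC subrK => ->.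
suff /eqP : p * q = 0.
  rewrite mulf_eq0 (negPf p_neq0) /= => /eqP q0.
  by have := qE 0 (conjC0 _); rewrite q0 horner0 scale0r addr0.
apply: (poly_eq0_infinite (@natr_inj C)) => n.
rewrite hornerM -pE ?conjC_nat // -qE ?conjC_nat //.
have [->|/fg->] := eqVneq (f (a + n%:R *: (a0 - a))) 0; first exact: mul0r.
exact: mulr0.
Qed.

End RealPolynomials.

(** * The Hermitian form *)

Section Forms.
Variables (R : realType) (m k : nat).
Local Notation C := (Cplx R).
Implicit Types (a b x y z : 'cV[C]_m) (t : C).

Lemma hdotDl a b y : hdot (a + b) y = hdot a y + hdot b y.
Proof. by rewrite -big_split; apply: eq_bigr => l _; rewrite mxE mulrDl. Qed.

Lemma hdotZl t a y : hdot (t *: a) y = t * hdot a y.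
Proof. by rewrite mulr_sumr; apply: eq_bigr => l _; rewrite mxE mulrA. Qed.

Lemma hdotC a b : (hdot a b)^* = hdot b a.
Proof.
rewrite rmorph_sum; apply: eq_bigr => l _.
by rewrite rmorphM /= conjCK mulrC.
Qed.

Lemma hdotDr a b y : hdot y (a + b) = hdot y a + hdot y b.
Proof. by rewrite -hdotC hdotDl rmorphD /= !hdotC. Qed.

Lemma hdotZr t a y : hdot y (t *: a) = t^* * hdot y a.
Proof. by rewrite -hdotC hdotZl rmorphM /= hdotC. Qed.

Lemma hdot0l y : hdot 0 y = 0.
Proof. by rewrite -(scale0r (0 : 'cV_m)) hdotZl mul0r. Qed.

Lemma hdot0r y : hdot y 0 = 0.
Proof. by rewrite -hdotC hdot0l conjC0. Qed.

Lemma hdot_sumr (I : finType) (f : I -> 'cV[C]_m) y :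
  hdot y (\sum_i f i) = \sum_i hdot y (f i).
Proof. exact: (big_morph (hdot y) (fun u v => hdotDr u v y) (hdot0r y)). Qed.

Lemma hdotE (a b : 'cV[C]_m) : hdot a b = (a^T *m map_mx Num.conj b) 0 0.
Proof. by rewrite mxE; apply: eq_bigr => l _; rewrite !mxE. Qed.

Lemma hdot_eq0 y : (forall x, hdot x y = 0) -> y = 0.
Proof.
move=> y0; apply/colP => l; rewrite mxE.
have := y0 (delta_mx l 0); rewrite /hdot (bigD1 l) //= big1 => [|i ne_il].
  by rewrite mxE !eqxx mul1r addr0 => /eqP; rewrite conjC_eq0 => /eqP.
by rewrite mxE (negPf ne_il) mul0r.
Qed.

Lemma hdot_hermsym (M : 'M[C]_m) x y :
  M \is hermsymmx -> hdot (M *m x) y = hdot x (M *m y).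
Proof.
move=> /is_hermitianmxP hM; rewrite /hdot.
under eq_bigr do rewrite mxE mulr_suml.
under [RHS]eq_bigr do rewrite mxE rmorph_sum mulr_sumr.
rewrite exchange_big; apply: eq_bigr => i _; apply: eq_bigr => l _.
by rewrite {1}hM expr0 scale1r !mxE rmorphM /=; ring.
Qed.

Lemma ofreal_conj (r : R) : (ofreal r)^* = ofreal r.
Proof. by apply/CrealP/complex_realP; exists r. Qed.

Lemma Cplx_realP (c : C) : c^* = c -> exists r : R, c = ofreal r.
Proof. by move=> /CrealP /complex_realP. Qed.

Lemma Cplx_rect (c : C) : exists r s : R, c = ofreal r + 'i * ofreal s.
Proof.
have [r rE] : exists r : R, 'Re c = ofreal r.
  by apply: Cplx_realP; apply: conj_Creal; apply: Creal_Re.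
have [s sE] : exists r : R, 'Im c = ofreal r.
  by apply: Cplx_realP; apply: conj_Creal; apply: Creal_Im.
by exists r, s; rewrite -rE -sE -Crect.
Qed.

Variable A : 'I_k -> 'M[C]_m.
Local Notation F := (formF A).

Lemma formFE a b j : F a b j 0 = hdot (A j *m a) b.
Proof. by rewrite mxE. Qed.

Lemma formFDl a b y : F (a + b) y = F a y + F b y.
Proof. by apply/colP => j; rewrite !mxE mulmxDr hdotDl. Qed.

Lemma formFZl t a y : F (t *: a) y = t *: F a y.
Proof. by apply/colP => j; rewrite !mxE -scalemxAr hdotZl. Qed.

Lemma formFZr t a y : F y (t *: a) = t^* *: F y a.
Proof. by apply/colP => j; rewrite !mxE hdotZr. Qed.

Lemma formF0l y : F 0 y = 0.
Proof. by rewrite -(scale0r (0 : 'cV_m)) formFZl scale0r. Qed.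

Lemma formF0r y : F y 0 = 0.
Proof. by rewrite -(scale0r (0 : 'cV_m)) formFZr conjC0 scale0r. Qed.

Hypothesis hermA : hermitian_form A.

Lemma formF_conj a b j : (F a b j 0)^* = F b a j 0.
Proof. by rewrite !mxE hdotC hdot_hermsym. Qed.

Lemma formF_conj_mx a b : map_mx Num.conj (F a b) = F b a.
Proof. by apply/colP => j; rewrite mxE formF_conj. Qed.

Lemma hdot_comb (c : 'cV[R]_k) a b :
  hdot (comb A c *m a) b = \sum_j ofreal (c j 0) * F a b j 0.
Proof.
rewrite -hdotC /comb mulmx_suml hdot_sumr rmorph_sum; apply: eq_bigr => j _.
by rewrite /= -scalemxAl hdotC hdotZl -formFE.
Qed.

Hypothesis ndA : nondegenerate_form A.

Lemma formF_eq0l z : (forall y, F z y = 0) -> z = 0.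
Proof.
by move=> z0; apply: ndA.2 => y; rewrite -formF_conj_mx z0 map_mx0.
Qed.

End Forms.

(** Isolated from the matrices [A_j] because the equations of weight three and
    their analysis only use sesquilinearity and Hermitian symmetry. *)
Definition hermitian_pairing (C : numClosedFieldType) m k
    (F : 'cV[C]_m -> 'cV[C]_m -> 'cV[C]_k) :=
  [/\ forall a b y, F (a + b) y = F a y + F b y,
      forall t a y, F (t *: a) y = t *: F a y &
      forall a b, map_mx Num.conj (F a b) = F b a].

Section Pairing.
Variables (C : numClosedFieldType) (m k : nat).
Variable F : 'cV[C]_m -> 'cV[C]_m -> 'cV[C]_k.
Hypothesis hF : hermitian_pairing F.

Lemma pairingDl a b y : F (a + b) y = F a y + F b y. Proof. by case: hF. Qed.
Lemma pairingZl t a y : F (t *: a) y = t *: F a y. Proof. by case: hF. Qed.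
Lemma pairing_conj a b : map_mx Num.conj (F a b) = F b a.
Proof. by case: hF. Qed.

Lemma pairing_conjE a b j : (F a b j 0)^* = F b a j 0.
Proof. by rewrite -(pairing_conj a b) mxE. Qed.

Lemma pairingDr a b y : F y (a + b) = F y a + F y b.
Proof. by rewrite -pairing_conj pairingDl map_mxD !pairing_conj. Qed.

Lemma pairingZr t a y : F y (t *: a) = t^* *: F y a.
Proof. by rewrite -pairing_conj pairingZl map_mxZ pairing_conj. Qed.

Lemma pairing0l y : F 0 y = 0.
Proof. by rewrite -(scale0r (0 : 'cV_m)) pairingZl scale0r. Qed.

Lemma pairing0r y : F y 0 = 0.
Proof. by rewrite -pairing_conj pairing0l map_mx0. Qed.

End Pairing.

(** * T-nondegeneracy *)

Section Duality.
Variables (C : numClosedFieldType) (m k : nat).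
Local Notation conj := (map_mx (@Num.conj C)).

Lemma conj_mxK p q (M : 'M[C]_(p, q)) : conj (conj M) = M.
Proof. by apply/matrixP => i j; rewrite !mxE conjCK. Qed.

(** The orthogonal of the orthogonal of a subspace is the subspace itself, used
    twice.  The hypothesis is tested on the [y] orthogonal to all [D conj(v)]
    with [D v = 0]; that the inner equation is then solvable in [x] is duality
    for the image of the adjoint of [D]. *)
Lemma image_conj_ker (D : 'M[C]_(m, k)) (w : 'cV[C]_m) :
  (forall y : 'cV[C]_m,
     (exists x, (conj D)^T *m x + D^T *m conj y = 0) -> w^T *m conj y = 0) ->
  exists2 v : 'cV[C]_k, D *m v = 0 & w = D *m conj v.
Proof.
move=> orth_w.
pose K := conj (kermx D^T).
have col_mul p q r (M : 'M[C]_(p, q)) (N : 'M[C]_(q, r)) l :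
    col l (M *m N) = M *m col l N by rewrite !colE mulmxA.
have /submxP[X wX] : (w^T <= K *m D^T)%MS.
  rewrite submxE; apply/eqP/matrixP => i l; rewrite ord1 [RHS]mxE.
  set Q := cokermx (K *m D^T).
  have -> : (w^T *m Q) 0 l = (w^T *m conj (conj (col l Q))) 0 0.
    by rewrite conj_mxK -col_mul [RHS]mxE.
  rewrite orth_w ?mxE // conj_mxK.
  have KQ : K *m (D^T *m col l Q) = 0.
    rewrite -!col_mul mulmxA mulmx_coker.
    by apply/matrixP => ? ?; rewrite !mxE.
  pose r := - (D^T *m col l Q).
  (* Solvability in x: the cokernel of conj D is conjugate to the kernel of D, and
     r pairs to zero with it. *)
  have /submxP[x xE] : (r^T <= conj D)%MS.
    rewrite submxE /r.
    have /submxP[Y YE] : (conj (cokermx (conj D))^T <= kermx D^T)%MS.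
      apply/sub_kermxP; rewrite -map_trmx -trmx_mul -[D in D *m _]conj_mxK.
      by rewrite -map_mxM mulmx_coker map_mx0 trmx0.
    have cE : (cokermx (conj D))^T = conj Y *m K.
      by rewrite -map_mxM -YE conj_mxK.
    rewrite -[cokermx _]trmxK cE -trmx_mul mulmxN -mulmxA.
    by rewrite KQ mulmx0 oppr0 trmx0.
  by exists x^T; rewrite -trmx_mul -xE trmxK /r addNr.
exists (conj (X *m K)^T).
  rewrite -[D]trmxK -map_trmx -trmx_mul map_mxM conj_mxK -mulmxA mulmx_ker.
  by rewrite mulmx0 trmx0.
by rewrite conj_mxK -[w]trmxK wX mulmxA trmx_mul trmxK.
Qed.

End Duality.

Section Tnondeg.
Local Open Scope classical_set_scope.
Variables (R : realType) (m k : nat).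
Local Notation C := (Cplx R).
Variable A : 'I_k -> 'M[C]_m.
Hypothesis hermA : hermitian_form A.
Local Notation F := (formF A).
Local Notation conj := (map_mx (@Num.conj C)).

Lemma Dmx_mul a v : Dmx A a *m v = \sum_j v j 0 *: (A j *m a).
Proof.
apply/colP => l; rewrite mxE summxE; apply: eq_bigr => j _.
by rewrite [Dmx _ _ _ _]mxE [RHS]mxE mulrC.
Qed.

Lemma Dmx_adj_mul a x : conj (Dmx A a)^T *m x = F x a.
Proof.
apply/colP => j; rewrite formFE hdot_hermsym // mxE.
by apply: eq_bigr => l _; rewrite !mxE mulrC.
Qed.

Lemma Dmx_tr_mul a y : (Dmx A a)^T *m conj y = F a y.
Proof. by rewrite -(formF_conj_mx hermA) -Dmx_adj_mul map_mxM conj_mxK. Qed.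

(** The coefficients [F_j(a,a)] are real, so this sum is conjugated when [u]
    is. *)
Lemma hdot_Dmx a u : hdot (Dmx A a *m u) a = \sum_j u j 0 * F a a j 0.
Proof.
rewrite Dmx_mul -hdotC hdot_sumr rmorph_sum; apply: eq_bigr => j _.
by rewrite hdotZr rmorphM /= conjCK hdotC formFE.
Qed.

Lemma Bmx_mul c a v :
  Bmx A c a *m v = F (invmx (comb A c) *m (Dmx A a *m v)) a.
Proof. by rewrite /Bmx -!mulmxA Dmx_adj_mul. Qed.

(** At a good point, [z] in [T(a)^F] is [A^-1 D conj(v)] with both [B conj(v)] and
    [conj(B) conj(v)] zero, and [Re B] is injective. *)
Lemma orthF_Tset_eq0 c a :
  comb A c \in unitmx -> Re_mx (Bmx A c a) \in unitmx ->
  orthF A (Tset A a) = [set 0].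
Proof.
move=> Ac_unit ReB_unit; apply/seteqP; split=> z /=; last first.
  by move=> -> y _; rewrite formF0l.
move=> zT.
have /choice2[v Dv AzE] j : exists2 v : 'cV[C]_k, Dmx A a *m v = 0 &
    A j *m z = Dmx A a *m conj v.
  apply: image_conj_ker => y [x]; rewrite map_trmx Dmx_adj_mul Dmx_tr_mul => xy.
  have /(congr1 (fun M : 'cV_k => M j 0)) := zT y (ex_intro _ x xy).
  rewrite formFE hdotE [RHS]mxE => zy0.
  by apply/matrixP => i i'; rewrite !ord1 zy0 mxE.
(* F(z,a) is conjugate to sum_l v_l F_l(a,a), the product of D v = 0 with a. *)
have Fza : F z a = 0.
  apply/colP => j; rewrite formFE AzE hdot_Dmx [RHS]mxE.
  have /(congr1 Num.conj) := hdot_Dmx a (v j).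
  rewrite Dv hdot0l conjC0 rmorph_sum => D0; apply: etrans (esym D0).
  apply: eq_bigr => l _.
  by rewrite rmorphM /= (formF_conj hermA) [conj _ _ _]mxE.
pose V := \sum_j ofreal (c j 0) *: v j.
have DV : Dmx A a *m V = 0.
  rewrite mulmx_sumr big1 // => j _.
  by rewrite -scalemxAr Dv scaler0.
have AzV : comb A c *m z = Dmx A a *m conj V.
  rewrite /comb mulmx_suml raddf_sum mulmx_sumr; apply: eq_bigr => j _.
  by rewrite -scalemxAl AzE /= map_mxZ /= ofreal_conj -scalemxAr.
have zE : z = invmx (comb A c) *m (Dmx A a *m conj V) by rewrite -AzV mulKmx.
have BV : Bmx A c a *m conj V = 0 by rewrite Bmx_mul -zE Fza.
have BV' : conj (Bmx A c a) *m conj V = 0.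
  by rewrite -map_mxM Bmx_mul DV mulmx0 formF0l map_mx0.
have V0 : conj V = 0.
  rewrite -[LHS](mulKmx ReB_unit) /Re_mx -scalemxAl mulmxDl BV BV' addr0.
  by rewrite scaler0 mulmx0.
by rewrite zE V0 !mulmx0.
Qed.

Lemma hdot_adj_comb c a j y : comb A c \in unitmx ->
  hdot (comb A c *m (invmx (comb A c) *m (A j *m a))) y = F a y j 0.
Proof. by move=> Ac_unit; rewrite mulKVmx // formFE. Qed.

(** The columns of [2 Re B] are therefore the vectors [F(d_j,a) + F(a,d_j)] for
    the dual vectors [d_j = A^-1 A_j a]. *)
Lemma Bmx_entry c a i j :
  Bmx A c a i j = F (invmx (comb A c) *m (A j *m a)) a i 0.
Proof.
have -> : A j *m a = Dmx A a *m delta_mx j 0.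
  by rewrite -colE; apply/colP => l; rewrite !mxE.
by rewrite -Bmx_mul -colE [RHS]mxE.
Qed.

Lemma realpoly_formF (x y : 'cV[C]_m -> 'cV[C]_m) j :
  (forall l, realpoly (fun a => x a l 0)) ->
  (forall l, realpoly (fun a => y a l 0)) ->
  realpoly (fun a => F (x a) (y a) j 0).
Proof.
move=> px py; apply: (@eq_realpoly _ _
    (fun a => \sum_l (\sum_i A j l i * x a i 0) * (y a l 0)^*)) => [a|].
  by rewrite mxE; apply: eq_bigr => l _; rewrite mxE.
apply: realpoly_sum => l; apply: realpolyM; last exact: realpoly_conj.
by apply: realpoly_sum => i; apply: realpolyM; first exact: realpoly_cst.
Qed.

Lemma realpoly_mulmx (M : 'M[C]_m) (x : 'cV[C]_m -> 'cV[C]_m) l :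
  (forall l, realpoly (fun a => x a l 0)) ->
  realpoly (fun a => (M *m x a) l 0).
Proof.
move=> px; apply: (@eq_realpoly _ _ (fun a => \sum_i M l i * x a i 0)) => [a|].
  by rewrite mxE.
by apply: realpoly_sum => i; apply: realpolyM; first exact: realpoly_cst.
Qed.

Lemma realpoly_det_ReB c : realpoly (fun a => \det (Re_mx (Bmx A c a))).
Proof.
apply: realpoly_det => i j.
have pB : realpoly (fun a => Bmx A c a i j).
  apply: (@eq_realpoly _ _ (fun a => F (invmx (comb A c) *m (A j *m a)) a i 0)).
    by move=> a; rewrite Bmx_entry.
  apply: realpoly_formF => l; last exact: realpoly_coord.
  apply: realpoly_mulmx => l'; apply: realpoly_mulmx => l''.
  exact: realpoly_coord.
apply: (@eq_realpoly _ _ (fun a => 2^-1 * (Bmx A c a i j + (Bmx A c a i j)^*))).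
  by move=> a; rewrite !mxE.
have pReB := realpolyD pB (realpoly_conj pB).
exact: realpolyM (realpoly_cst _ _) pReB.
Qed.

Lemma Dnondegenerate_Tnondegenerate :
  nondegenerate_form A -> Dnondegenerate A -> Tnondegenerate A.
Proof.
move=> ndA [c [a0 [Ac_unit ReB_unit]]]; split=> //.
have pdet := realpoly_det_ReB c.
exists [set a | \det (Re_mx (Bmx A c a)) != 0]; split.
- exact: open_realpoly_neq0.
- by apply: (dense_realpoly_neq0 (a0 := a0)) => //; rewrite -unitfE -unitmxE.
by move=> a ReB; apply: (orthF_Tset_eq0 (c := c)); rewrite // unitmxE unitfE.
Qed.

Lemma hermitian_pairing_formF : hermitian_pairing F.
Proof.
split=> [a b y|t a y|a b]; first exact: formFDl.
  exact: formFZl.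
exact: formF_conj_mx.
Qed.

End Tnondeg.

(** * Complexification of the tangency condition *)

Section ComplexPoly.
Variable (C : numClosedFieldType).

Definition polyfun (h : C -> C) := exists p : {poly C}, forall t, h t = p.[t].

Lemma polyfun_cst c : polyfun (fun=> c).
Proof. by exists c%:P => t; rewrite hornerC. Qed.

Lemma polyfun_id : polyfun id.
Proof. by exists 'X => t; rewrite hornerX. Qed.

Lemma polyfunD f g : polyfun f -> polyfun g -> polyfun (fun t => f t + g t).
Proof. by move=> [p pE] [q qE]; exists (p + q) => t; rewrite hornerD pE qE. Qed.

Lemma polyfunM f g : polyfun f -> polyfun g -> polyfun (fun t => f t * g t).
Proof. by move=> [p pE] [q qE]; exists (p * q) => t; rewrite hornerM pE qE. Qed.

Lemma polyfun_sum (I : Type) (r : seq I) (f : I -> C -> C) :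
  (forall i, polyfun (f i)) -> polyfun (fun t => \sum_(i <- r) f i t).
Proof.
move=> /choice[p pE]; exists (\sum_(i <- r) p i) => t.
by rewrite horner_sum; apply: eq_bigr.
Qed.

Lemma polyfun_prod (I : Type) (r : seq I) (f : I -> C -> C) :
  (forall i, polyfun (f i)) -> polyfun (fun t => \prod_(i <- r) f i t).
Proof.
move=> /choice[p pE]; exists (\prod_(i <- r) p i) => t.
by rewrite horner_prod; apply: eq_bigr.
Qed.

Lemma polyfunX f n : polyfun f -> polyfun (fun t => f t ^+ n).
Proof. by move=> [p pE]; exists (p ^+ n) => t; rewrite horner_exp pE. Qed.

Lemma polyfun_conj f : polyfun f -> polyfun (fun t => (f t^*)^*).
Proof.
move=> [p pE]; exists (map_poly Num.conj p) => t.
by rewrite pE -horner_map /= conjCK.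
Qed.

Lemma polyfun_meval n (q : mpoly n C) (v : C -> 'I_n -> C) :
  (forall i, polyfun (v^~ i)) -> polyfun (fun t => meval (v t) q).
Proof.
move=> pv; have [p pE] : polyfun (fun t => \sum_(mon <- msupp q)
    mcoeff mon q * \prod_i v t i ^+ mon i).
  apply: polyfun_sum => mon; apply: polyfunM; first exact: polyfun_cst.
  by apply: polyfun_prod => i; apply: polyfunX.
by exists p => t; rewrite mevalE pE.
Qed.

(** The Schwarz reflection principle for polynomials: [f] and its reflection
    agree at the infinitely many real points. *)
Lemma polyfun_reflection f : polyfun f ->
  (forall t, t^* = t -> (f t)^* = f t) -> forall t, (f t^*)^* = f t.
Proof.
move=> pf real_f t; have [p pE] := pf; have [q qE] := polyfun_conj pf.
suff pq : p = q by rewrite qE pE pq.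
apply/eqP; rewrite -subr_eq0; apply/eqP.
apply: (poly_eq0_infinite (@natr_inj C)) => n.
by rewrite hornerD hornerN -pE -qE conjC_nat real_f ?conjC_nat ?subrr.
Qed.

End ComplexPoly.

Section Segre.
Variables (R : realType) (m k : nat).
Local Notation C := (Cplx R).
Variable A : 'I_k -> 'M[C]_m.
Local Notation F := (formF A).

(** The form is antilinear in its second argument, whence the conjugate
    parameter there. *)
Lemma polyfun_formF (a b : C -> 'cV[C]_m) j :
  (forall l, polyfun (fun t => a t l 0)) ->
  (forall l, polyfun (fun t => b t l 0)) ->
  polyfun (fun t => F (a t) (b t^*) j 0).
Proof.
move=> pa pb.
have [p pE] :
    polyfun (fun t => \sum_l (\sum_i A j l i * a t i 0) * (b t^* l 0)^*).
  apply: polyfun_sum => l; apply: polyfunM; last exact: polyfun_conj (pb l).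
  by apply: polyfun_sum => i; apply: polyfunM (pa i); apply: polyfun_cst.
by exists p => t; rewrite -pE mxE; apply: eq_bigr => l _; rewrite mxE.
Qed.

Variables (p : int) (fg : 'cV[mpoly (m + k) C]_m * 'cV[mpoly (m + k) C]_k).
Hypothesis fg_p : g_ A p fg.
Local Notation f := (eval_zw fg.1).
Local Notation g := (eval_zw fg.2).

(** The tangency condition is complexified along a complex line in the space of
    real parameters.  For given [z], [zeta], [v], take the real-parametrized
    line through [z0 = (z + zeta)/2] in the direction [z1 = (z - zeta)/2i], and
    similarly for [u]: on it the expression is a polynomial in [t] that is real
    for real [t], and its reflection at [t = i] is the claim, because
    [z0 + i z1 = z] and [z0 - i z1 = zeta]. *)
Lemma segre_identity z zeta v j :
  let w := v + 'i *: F z zeta in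
  let w' := map_mx Num.conj v + 'i *: F zeta z in
  g z w j 0 - 2 * 'i * F (f z w) zeta j 0 =
  (g zeta w' j 0 - 2 * 'i * F (f zeta w') z j 0)^*.
Proof.
have [_ _ tangent] := fg_p.
pose z0 : 'cV[C]_m := 2^-1 *: (z + zeta).
pose z1 : 'cV[C]_m := (2 * 'i)^-1 *: (z - zeta).
have /choice[u0 /choice[u1 vE]] l := Cplx_rect (v l 0).
pose Z t : 'cV[C]_m := z0 + t *: z1.
pose V t : 'cV[C]_k := \col_l (ofreal (u0 l) + t * ofreal (u1 l)).
pose W t := V t + 'i *: F (Z t) (Z t^*).
pose Q t := g (Z t) (W t) j 0 - 2 * 'i * F (f (Z t) (W t)) (Z t^*) j 0.
have i_neq0 : 'i != 0 :> C by rewrite neq0Ci.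
(* At t = i the line passes through (z, zeta, v). *)
have Zi : Z 'i = z by apply/colP => l; rewrite !mxE; field.
have ZNi : Z 'i^* = zeta by rewrite conjCi; apply/colP => l; rewrite !mxE; field.
have Vi : V 'i = v by apply/colP => l; rewrite !mxE vE.
have VNi : V 'i^* = map_mx Num.conj v.
  by apply/colP => l; rewrite !mxE vE rmorphD rmorphM /= !ofreal_conj.
have pZ l : polyfun (fun t => Z t l 0).
  have [q qE] := polyfunD (polyfun_cst (z0 l 0))
                   (polyfunM (@polyfun_id C) (polyfun_cst (z1 l 0))).
  by exists q => t; rewrite -qE !mxE.
have pW l : polyfun (fun t => W t l 0).
  have [q qE] := polyfunD (polyfunD (polyfun_cst (ofreal (u0 l)))
      (polyfunM (@polyfun_id C) (polyfun_cst (ofreal (u1 l)))))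
    (polyfunM (polyfun_cst 'i) (polyfun_formF l pZ pZ)).
  by exists q => t; rewrite -qE !mxE.
have pZW (n : nat) (q : 'cV[mpoly (m + k) C]_n) l :
    polyfun (fun t => eval_zw q (Z t) (W t) l 0).
  have pv s : polyfun (fun t => col_mx (Z t) (W t) s 0).
    case: (split_ordP s) => i ->.
      by have [r rE] := pZ i; exists r => t; rewrite col_mxEu.
    by have [r rE] := pW i; exists r => t; rewrite col_mxEd.
  have [r rE] := polyfun_meval (q l 0) pv.
  by exists r => t; rewrite mxE rE.
have pQ : polyfun Q.
  apply: polyfunD (pZW _ _ _) _.
  have [q qE] := polyfunM (polyfun_cst (- (2 * 'i)))
    (polyfun_formF j (pZW _ fg.1) pZ).
  by exists q => t; rewrite -qE mulNr.
(* Reality on the real line is the tangency condition itself. *)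
have realQ t : t^* = t -> (Q t)^* = Q t.
  move=> tR; apply/conj_Creal/Creal_ImP.
  have /Cplx_realP[r rE] := tR.
  have := tangent (Z t) (\col_l (u0 l + r * u1 l)) j.
  rewrite /Q tR /=.
  have -> : map_mx (@ofreal R) (\col_l (u0 l + r * u1 l)) = V t.
    by apply/colP => l; rewrite !mxE rE /ofreal rmorphD rmorphM.
  by rewrite /W tR !mxE => <-.
have /= := polyfun_reflection pQ realQ 'i.
by rewrite /Q /W conjCK Vi VNi Zi ZNi => ->.
Qed.

End Segre.

(** * The equations of weight three *)

Section Weight3.
Variables (C : numClosedFieldType) (m k : nat).
Variable F : 'cV[C]_m -> 'cV[C]_m -> 'cV[C]_k.
Hypothesis hF : hermitian_pairing F.
Hypothesis ndF : forall z, (forall y, F z y = 0) -> z = 0.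

(** Setting [zeta = 0] gives [g].  For the rest, take [w = v + i F(z,zeta)], so that
    [conj(w') = v - i F(z,zeta)], and replace [z] by [n z] with [n] a natural
    number, on which conjugation has no effect.  The coefficients of [n^4] and
    [n^3] give the vanishing of [p4] and the first equation for [p2]; that of
    [n^2] gives the second one, up to a term which is the conjugate of the first
    with [z] and [zeta] exchanged. *)
Lemma weight3_equations (f : 'cV[C]_m -> 'cV[C]_k -> 'cV[C]_m)
    (g : 'cV[C]_m -> 'cV[C]_k -> 'cV[C]_k)
    (p4 : 'cV[C]_m -> 'cV[C]_m) (p2 : 'cV[C]_m -> 'cV[C]_k -> 'cV[C]_m)
    (b : 'cV[C]_k -> 'cV[C]_k -> 'cV[C]_m) :
  (forall t z, p4 (t *: z) = t ^+ 4 *: p4 z) ->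
  (forall t z w, p2 (t *: z) w = t ^+ 2 *: p2 z w) ->
  (forall z v w, p2 z (v + w) = p2 z v + p2 z w) ->
  (forall t z w, p2 z (t *: w) = t *: p2 z w) ->
  symmetric_bilinear b ->
  (forall z w, f z w = p4 z + p2 z w + b w w) ->
  (forall w, g 0 w = 0) ->
  (forall z zeta v j,
    let w := v + 'i *: F z zeta in
    let w' := map_mx Num.conj v + 'i *: F zeta z in
    g z w j 0 - 2 * 'i * F (f z w) zeta j 0 =
    (g zeta w' j 0 - 2 * 'i * F (f zeta w') z j 0)^*) ->
  [/\ forall z, p4 z = 0,
      forall z w, g z w =
         (2 * 'i) *: F z (b (map_mx Num.conj w) (map_mx Num.conj w)),
      forall z zeta, F (p2 z (F z zeta)) zeta = 0 &
      forall z v zeta, F (p2 z v) zeta =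
        (4 * 'i) *: F z (b (map_mx Num.conj v) (F zeta z))].
Proof.
move=> p4Z p2Z p2D p2S [bD bS bC] fE g0 segre.
have p4_0 : p4 0 = 0 by rewrite -(scale0r (0 : 'cV_m)) p4Z expr0n /= !scale0r.
have p2_0 w : p2 0 w = 0.
  by rewrite -(scale0r (0 : 'cV_m)) p2Z expr0n /= !scale0r.
have f0 w : f 0 w = b w w by rewrite fE p4_0 p2_0 !add0r.
have gE z w : g z w =
    (2 * 'i) *: F z (b (map_mx Num.conj w) (map_mx Num.conj w)).
  apply/colP => j; have := segre z 0 w j.
  rewrite /= (pairing0l hF) !(pairing0r hF) scaler0 !addr0 g0 f0.
  rewrite ![(0 : 'cV_k) _ _]mxE mulr0 subr0 sub0r => ->; rewrite [RHS]mxE.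
  rewrite rmorphN !rmorphM /= (pairing_conjE hF) conjCi conjC_nat.
  by rewrite mulrN mulNr opprK.
have cZ t (M : 'cV[C]_k) j : (t *: M) j 0 = t * M j 0 by rewrite mxE.
have cD (M N : 'cV[C]_k) j : (M + N) j 0 = M j 0 + N j 0 by rewrite mxE.
have cJ (M : 'cV[C]_k) j : map_mx Num.conj M j 0 = (M j 0)^* by rewrite mxE.
have bDl u v w : b (u + v) w = b u w + b v w by rewrite !(bC _ w) bD.
have bSl t u w : b (t *: u) w = t *: b u w by rewrite !(bC _ w) bS.
have b_sqr v u s : b (v + s *: u) (v + s *: u) =
    b v v + (2 * s) *: b v u + s ^+ 2 *: b u u.
  rewrite (bD _ v (s *: u)) (bDl v _ v) (bDl v _ (s *: u)) (bSl s u v).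
  rewrite (bS s v u) (bS s (s *: u) u) (bSl s u u) (bC u v).
  by apply/colP => l; rewrite !mxE; ring.
(* For s = i and s' = -i, splits off from f(z, w) the value of b at conj(w'), which
   cancels against g(zeta, w'). *)
have fsplit z v u s s' : s ^+ 2 = s' ^+ 2 -> f z (v + s *: u) =
    (p4 z + p2 z v + s *: p2 z u + (2 * (s - s')) *: b v u)
    + b (v + s' *: u) (v + s' *: u).
  move=> ss'; rewrite fE (p2D z v (s *: u)) (p2S s z u) !b_sqr ss'.
  by apply/colP => l; rewrite !mxE; ring.
have key z zeta v j :
    F (p4 z + p2 z v + 'i *: p2 z (F z zeta)
       + (2 * ('i - - 'i)) *: b v (F z zeta)) zeta j 0 +
    F z (p4 zeta + p2 zeta (map_mx Num.conj v) + 'i *: p2 zeta (F zeta z)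
         + (2 * ('i - - 'i)) *: b (map_mx Num.conj v) (F zeta z)) j 0 = 0.
  have i2 : 'i ^+ 2 = (- 'i) ^+ 2 :> C by rewrite sqrrN.
  have := segre z zeta v j.
  rewrite /= !gE (fsplit z v _ _ _ i2) (fsplit zeta _ _ _ _ i2).
  have conj_w (x y : 'cV[C]_m) (u : 'cV[C]_k) :
      map_mx Num.conj (u + 'i *: F x y) = map_mx Num.conj u + (- 'i) *: F y x.
    apply/colP => l.
    by rewrite cJ !cD !cZ cJ rmorphD rmorphM /= (pairing_conjE hF) conjCi.
  have conjK (u : 'cV[C]_k) : map_mx Num.conj (map_mx Num.conj u) = u.
    by apply/colP => l; rewrite !mxE conjCK.
  rewrite !conj_w conjK ![F (_ + b _ _) _](pairingDl hF).
  set P := (_ + _ *: b v _); set P' := (_ + _ *: b (map_mx _ v) _).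
  set B := b (v + _) _; set B' := b (map_mx _ v + _) _.
  rewrite !cZ !cD rmorphB !rmorphM (rmorphD _ (F P' z j 0)) /=.
  rewrite !(pairing_conjE hF) conjCi conjC_nat => /eqP.
  rewrite -subr_eq0 => /eqP/(congr1 -%R); rewrite oppr0 => E.
  apply: (@mulfI _ (2 * 'i)); first by rewrite mulf_neq0 ?neq0Ci ?pnatr_eq0.
  by rewrite mulr0; apply: etrans E; ring.
(* The coefficients of n^4, n^3 and n^2 after scaling z by n. *)
have {}key z zeta v j :
  [/\ F (p4 z) zeta j 0 = 0, F (p2 z (F z zeta)) zeta j 0 = 0 &
     F (p2 z v) zeta j 0 + F z ('i *: p2 zeta (F zeta z)) j 0
     + F z ((2 * ('i - - 'i)) *: b (map_mx Num.conj v) (F zeta z)) j 0 = 0].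
  pose c1 := F ((2 * ('i - - 'i)) *: b v (F z zeta)) zeta j 0
             + F z (p4 zeta + p2 zeta (map_mx Num.conj v)) j 0.
  have [//|_ _ c2 c3 c4] := @poly4_eq0 C 0 c1
    (F (p2 z v) zeta j 0 + F z ('i *: p2 zeta (F zeta z)) j 0
     + F z ((2 * ('i - - 'i)) *: b (map_mx Num.conj v) (F zeta z)) j 0)
    (F ('i *: p2 z (F z zeta)) zeta j 0) (F (p4 z) zeta j 0).
    move=> n; have := key (n%:R *: z) zeta v j.
    rewrite p4Z !p2Z !(pairingZl hF) !(pairingZr hF) conjC_nat !bS !p2S.
    rewrite /c1 !(pairingDl hF) !(pairingDr hF) !(pairingZl hF) !(pairingZr hF).
    rewrite !(cD, cZ) !rmorphM /= !conjC_nat.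
    by move=> E; apply: etrans E; rewrite ?add0r; ring.
  split=> //; move: c3; rewrite (pairingZl hF) cZ => /eqP.
  by rewrite mulf_eq0 (negPf (neq0Ci C)) => /eqP.
have p4_eq0 z : p4 z = 0.
  apply: ndF => y; apply/colP => j.
  by have [-> _ _] := key z y 0 j; rewrite mxE.
have p2F z zeta : F (p2 z (F z zeta)) zeta = 0.
  by apply/colP => j; have [_ -> _] := key z zeta 0 j; rewrite mxE.
split=> // z v zeta.
apply/colP => j; have [_ _] := key z zeta v j.
rewrite !(pairingZr hF) -[F z (p2 _ _)](pairing_conj hF) p2F map_mx0 scaler0.
rewrite [(0 : 'cV_k) _ _]mxE addr0 !cZ rmorphM /= rmorphB rmorphN /=.
rewrite conjCi conjC_nat.
by move/eqP; rewrite addr_eq0 => /eqP->; ring.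
Qed.

End Weight3.

(** * Vanishing of the quadratic part *)

Section PointwiseVanishing.
Variables (C : numClosedFieldType) (m k : nat).
Variable F : 'cV[C]_m -> 'cV[C]_m -> 'cV[C]_k.
Hypothesis hF : hermitian_pairing F.
Variable c : 'cV[C]_k.
Hypothesis c_real : forall j, (c j 0)^* = c j 0.

(** The scalar Hermitian form of the matrix [sum_j c_j A_j]. *)
Definition combF a b : C := \sum_j c j 0 * F a b j 0.
Local Notation G := combF.

Lemma combF_conj a b : (G a b)^* = G b a.
Proof.
rewrite rmorph_sum; apply: eq_bigr => j _.
by rewrite rmorphM /= c_real (pairing_conjE hF).
Qed.

Lemma combFDl a b y : G (a + b) y = G a y + G b y.
Proof.
rewrite -big_split; apply: eq_bigr => j _.
by rewrite (pairingDl hF) mxE mulrDr.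
Qed.

Lemma combFZl t a y : G (t *: a) y = t * G a y.
Proof.
rewrite mulr_sumr; apply: eq_bigr => j _.
by rewrite (pairingZl hF) mxE mulrCA.
Qed.

Lemma combFDr a b y : G y (a + b) = G y a + G y b.
Proof.
by rewrite -combF_conj combFDl rmorphD /= !combF_conj.
Qed.

Lemma combFZr t a y : G y (t *: a) = t^* * G y a.
Proof. by rewrite -combF_conj combFZl rmorphM /= combF_conj. Qed.

Variable b : 'cV[C]_k -> 'cV[C]_k -> 'cV[C]_m.
Hypothesis sb : symmetric_bilinear b.

Lemma bilinDr u v w : b u (v + w) = b u v + b u w. Proof. by case: sb. Qed.
Lemma bilinZr t u v : b u (t *: v) = t *: b u v. Proof. by case: sb. Qed.
Lemma bilinC u v : b u v = b v u. Proof. by case: sb. Qed.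
Lemma bilinDl u v w : b (u + v) w = b u w + b v w.
Proof. by rewrite !(bilinC _ w) bilinDr. Qed.
Lemma bilinZl t u v : b (t *: u) v = t *: b u v.
Proof. by rewrite !(bilinC _ v) bilinZr. Qed.

Lemma bilin_delta u w : b u w = \sum_l w l 0 *: b u (delta_mx l 0).
Proof.
rewrite {1}[w]matrix_sum_delta; under eq_bigr do rewrite big_ord1.
rewrite (big_morph (b u) (id1 := 0) (op1 := +%R)) => [|v w'|].
- by apply: eq_bigr => l _; rewrite bilinZr.
- exact: bilinDr.
by rewrite -(scale0r (0 : 'cV_k)) bilinZr scale0r.
Qed.

Hypothesis b_adj :
  forall z u, exists y, forall zeta, F y zeta = F z (b u (F zeta z)).
Hypothesis b_null : forall z zeta, F z (b (F zeta z) (F zeta z)) = 0.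

Variables (a : 'cV[C]_m) (dual : 'I_k -> 'cV[C]_m).
Hypothesis dualE : forall j y, G (dual j) y = F a y j 0.
Hypothesis dual_inj : forall g : 'I_k -> C,
  (forall j, \sum_l (F (dual j) a + F a (dual j)) l 0 * g l = 0) ->
  forall l, g l = 0.

(** The functional [w -> G(a, b(u,w))] vanishes on the vectors
    [F(d_j,a) + F(a,d_j)], which [dual_inj] makes sufficient.  Its value at
    [F(d_j,a)] is [sum_i c_i F_i(y, d_j) = conj(G(d_j, y)) = F_j(y, a)] for the
    vector [y] of [b_adj], which applied again gives [F_j(a, b(u, F(a,a)))]. *)
Lemma combF_b_eq0 u :
  (forall j, G a (b u (F a (dual j))) = - F a (b u (F a a)) j 0) ->
  forall w, G a (b u w) = 0.
Proof.
move=> hu.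
have La w : G a (b u w) = \sum_l (w l 0)^* * G a (b u (delta_mx l 0)).
  rewrite bilin_delta (big_morph (G a) (id1 := 0) (op1 := +%R)) => [|v w'|].
  - by apply: eq_bigr => l _; rewrite combFZr.
  - exact: combFDr.
  by rewrite -(scale0r (0 : 'cV_m)) combFZr conjC0 mul0r.
suff e0 : forall l, G a (b u (delta_mx l 0)) = 0.
  by move=> w; rewrite La big1 // => l _; rewrite e0 mulr0.
apply: (dual_inj (g := fun l => G a (b u (delta_mx l 0)))) => j.
have [y yE] := b_adj a u.
have Ldual : G a (b u (F (dual j) a)) = F a (b u (F a a)) j 0.
  rewrite -yE -(pairing_conjE hF) -dualE combF_conj.
  by apply: eq_bigr => i _; rewrite yE.
rewrite -[RHS](subrr (F a (b u (F a a)) j 0)) -{1}Ldual -hu -combFDr.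
rewrite -bilinDr La; apply: eq_bigr => l _; congr (_ * _).
by rewrite !mxE rmorphD /= !(pairing_conjE hF) addrC.
Qed.

(** The part of [b_null], taken at [zeta = a], that is linear in [x] when [z] is
    replaced by [a + x]. *)
Lemma b_null_polar x :
  F x (b (F a a) (F a a)) + 2 *: F a (b (F a a) (F a x)) = 0.
Proof.
apply/colP => j.
have [//|_ c1 _ _ _] := @poly4_eq0 C 0
  (F x (b (F a a) (F a a)) j 0 + 2 * F a (b (F a a) (F a x)) j 0)
  (F a (b (F a x) (F a x)) j 0 + 2 * F x (b (F a a) (F a x)) j 0)
  (F x (b (F a x) (F a x)) j 0) 0; last first.
  by rewrite !mxE -[RHS]c1.
move=> n; have := congr1 (fun M : 'cV_k => M j 0) (b_null (a + n%:R *: x) a).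
rewrite /= (pairingDr hF) (pairingZr hF) conjC_nat.
rewrite !(bilinDl, bilinDr, bilinZl, bilinZr) (bilinC (F a x) (F a a)).
rewrite (pairingDl hF) (pairingZl hF) !(pairingDr hF, pairingZr hF) !conjC_nat.
have /(congr1 (fun M : 'cV_k => M j 0)) /= := b_null a a.
rewrite !mxE => -> E.
by apply: etrans E; ring.
Qed.

(** For [u = F(a,a)] the right-hand side of the criterion is zero by [b_null],
    and the left-hand side is [-1/2 G(d_j, b(u,u)) = -1/2 F_j(a, b(u,u))], which
    is zero for the same reason. *)
Lemma combF_b_diag w : G a (b (F a a) w) = 0.
Proof.
apply: combF_b_eq0 => j; rewrite b_null mxE oppr0.
have G0 : G (dual j) (b (F a a) (F a a)) +
          2 * G a (b (F a a) (F a (dual j))) = 0.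
  rewrite mulr_sumr -big_split big1 // => i _ /=.
  have /(congr1 (fun M : 'cV_k => M i 0)) := b_null_polar (dual j).
  by rewrite !mxE mulrCA -mulrDr => ->; rewrite mulr0.
move: G0; rewrite dualE b_null mxE add0r => /eqP.
by rewrite mulf_eq0 pnatr_eq0 => /eqP.
Qed.

Hypothesis b_diag : forall z w, G z (b (F z z) w) = 0.

(** Polarizing [b_diag] gives three terms, of which [G(a, b(F(x,a), w))] is
    antilinear in [x] and the others are linear; replacing [x] by [i x] separates
    them. *)
Lemma combF_b_polar x w : G x (b (F a a) w) + G a (b (F a x) w) = 0.
Proof.
have polar y : G y (b (F a a) w) + G a (b (F y a) w) + G a (b (F a y) w) = 0.
  have [//|_ c1 _ _ _] := @poly4_eq0 C 0
    (G y (b (F a a) w) + G a (b (F y a) w) + G a (b (F a y) w))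
    (G a (b (F y y) w) + G y (b (F y a) w) + G y (b (F a y) w))
    (G y (b (F y y) w)) 0.
  move=> n; have := b_diag (a + n%:R *: y) w.
  rewrite (pairingDl hF) (pairingZl hF) !(pairingDr hF, pairingZr hF).
  rewrite conjC_nat !(bilinDl, bilinZl, scalerDr).
  rewrite combFDl combFZl !(combFDr, combFZr) !conjC_nat.
    by rewrite b_diag => E; apply: etrans E; ring.
  exact: c1.
have := polar ('i *: x).
rewrite (pairingZl hF) (pairingZr hF) !bilinZl combFZl !combFZr.
rewrite conjCK conjCi => polar_i.
apply: (@mulfI _ (2 * 'i)); first by rewrite mulf_neq0 ?pnatr_eq0 ?neq0Ci.
have -> : 2 * 'i * (G x (b (F a a) w) + G a (b (F a x) w)) =
    'i * (G x (b (F a a) w) + G a (b (F x a) w) + G a (b (F a x) w)) +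
    ('i * G x (b (F a a) w) + - 'i * G a (b (F x a) w) + 'i * G a (b (F a x) w)).
  by ring.
by rewrite polar polar_i !mulr0 addr0.
Qed.

Lemma combF_b u w : G a (b u w) = 0.
Proof.
apply: combF_b_eq0 => j; rewrite bilinC.
by apply/eqP; rewrite -addr_eq0 addrC -dualE [b u _]bilinC combF_b_polar.
Qed.

End PointwiseVanishing.

Section Vanishing.
Local Open Scope classical_set_scope.
Variables (R : realType) (m k : nat).
Local Notation C := (Cplx R).
Variable A : 'I_k -> 'M[C]_m.
Hypothesis hermA : hermitian_form A.
Local Notation F := (formF A).
Local Notation conj := (map_mx (@Num.conj C)).

Lemma Dnondegenerate_bilin_eq0 (b : 'cV[C]_k -> 'cV[C]_k -> 'cV[C]_m) :
  Dnondegenerate A -> symmetric_bilinear b ->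
  (forall z u, exists y, forall zeta, F y zeta = F z (b u (F zeta z))) ->
  (forall z zeta, F z (b (F zeta z) (F zeta z)) = 0) ->
  forall u w, b u w = 0.
Proof.
move=> [c [a0 [Ac_unit ReB_unit]]] sb b_adj b_null u w.
have hF := hermitian_pairing_formF hermA.
pose c' := map_mx (@ofreal R) c.
have c'_real j : (c' j 0)^* = c' j 0 by rewrite mxE ofreal_conj.
have GE x y : combF F c' x y = hdot (comb A c *m x) y.
  by rewrite hdot_comb //; apply: eq_bigr => j _; rewrite mxE.
pose dual (a : 'cV[C]_m) j := invmx (comb A c) *m (A j *m a).
have dualE a j y : combF F c' (dual a j) y = F a y j 0.
  by rewrite GE hdot_adj_comb.
have pdet := realpoly_det_ReB hermA c.
pose good a := \det (Re_mx (Bmx A c a)) != 0.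
have good0 : good a0 by rewrite /good -unitfE -unitmxE.
have dual_inj a : good a -> forall g : 'I_k -> C,
    (forall j, \sum_l (F (dual a j) a + F a (dual a j)) l 0 * g l = 0) ->
    forall l, g l = 0.
  rewrite /good -unitfE -unitmxE => ReB g g0 l.
  suff /(congr1 (mulmx^~ (invmx (Re_mx (Bmx A c a))))) :
      (\row_l g l) *m Re_mx (Bmx A c a) = 0.
    by rewrite mulmxK // mul0mx => /rowP/(_ l); rewrite !mxE.
  apply/rowP => j; rewrite [RHS]mxE -(mulr0 2^-1) -(g0 j) mxE mulr_sumr.
  apply: eq_bigr => i _; rewrite [Re_mx _ _ _]mxE [(_ + map_mx _ _) _ _]mxE.
  rewrite [map_mx _ _ _ _]mxE (Bmx_entry hermA) (formF_conj hermA).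
  rewrite [(_ + F _ _) _ _]mxE.
  by rewrite mxE; ring.
have pG (y : 'cV[C]_m -> 'cV[C]_m) :
    (forall l, realpoly (fun a => y a l 0)) ->
    realpoly (fun a => combF F c' a (y a)).
  move=> py; apply: realpoly_sum => j.
  apply: realpolyM; first exact: realpoly_cst.
  by apply: realpoly_formF => // l; apply: realpoly_coord.
have b_diag z w' : combF F c' z (b (F z z) w') = 0.
  apply: (realpoly_eq0 pdet
    (g := fun z => combF F c' z (b (F z z) w')) _ good0).
    apply: pG => l.
    apply: (@eq_realpoly _ _
        (fun a => \sum_i F a a i 0 * b w' (delta_mx i 0) l 0)) => [a|].
      rewrite (bilinC sb) (bilin_delta sb) summxE.
      by apply: eq_bigr => i _; rewrite [RHS]mxE.
    apply: realpoly_sum => i; apply: realpolyM; last exact: realpoly_cst.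
    by apply: realpoly_formF => l'; apply: realpoly_coord.
  move=> a good_a.
  exact: (combF_b_diag hF c'_real sb b_adj b_null (dualE a)
    (dual_inj a good_a)).
have b_lin z : combF F c' z (b u w) = 0.
  apply: (realpoly_eq0 pdet (g := fun z => combF F c' z (b u w)) _ good0).
    by apply: pG => l; apply: realpoly_cst.
  move=> a good_a.
  exact: (combF_b hF c'_real sb b_adj (dualE a) (dual_inj a good_a)
    b_diag).
apply: hdot_eq0 => x.
by rewrite -(mulKVmx Ac_unit x) -GE.
Qed.

(** The coefficient of degree two in [w] vanishes by D-nondegeneracy, and it
    controls all the others. *)
Lemma Dnondegenerate_g3_eq0 :
  nondegenerate_form A -> Dnondegenerate A -> g_ A 3 = [set (0, 0)].
Proof.
move=> ndA DndA; apply/seteqP; split=> [[f g] fg3 | _ ->] /=; last first.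
  have eval0 n z w : eval_zw (0 : 'cV[mpoly (m + k) C]_n) z w = 0.
    by apply/colP => l; rewrite !mxE meval0.
  split=> [l mon|j mon|z u j /=]; rewrite ?mxE ?msupp0 //.
  by rewrite !eval0 meval0 mulmx0 hdot0l mulr0 subrr raddf0.
have [wf wg _] := fg3.
have wf4 l := weighted_homogeneousP (d := 4) (wf l).
have wg5 l := weighted_homogeneousP (d := 5) (wg l).
have [p4 [p2 [p4Z p2Z p2D p2S] [b sb fE]]] := weight4_structure wf4.
have g0 w : eval_zw g 0 w = 0.
  by apply/colP => l; rewrite mxE [RHS]mxE (whomog_odd_eval0 _ _ (wg5 l)).
have [p4_0 gE p2_null p2E] := weight3_equations (hermitian_pairing_formF hermA)
  (@formF_eq0l _ _ _ A hermA ndA) p4Z p2Z p2D p2S sb fE g0 (segre_identity fg3).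
have b0 : forall u w, b u w = 0.
  apply: Dnondegenerate_bilin_eq0 => // [z u|z zeta].
    exists ((4 * 'i)^-1 *: p2 z (conj u)) => zeta.
    rewrite formFZl p2E conj_mxK scalerA mulVf ?scale1r //.
    by rewrite mulf_neq0 ?pnatr_eq0 ?neq0Ci.
  have := p2E z (F z zeta) zeta; rewrite p2_null formF_conj_mx // => /esym/eqP.
  rewrite scaler_eq0 mulf_eq0 pnatr_eq0 (negPf (neq0Ci _)) /=.
  by move=> /eqP.
have p2_0 z w : p2 z w = 0.
  apply: (formF_eq0l hermA ndA) => y.
  by rewrite p2E b0 formF0r scaler0.
have zero n (q : 'cV[mpoly (m + k) C]_n) :
    (forall z w, eval_zw q z w = 0) -> q = 0.
  move=> q0; apply/colP => l; rewrite [RHS]mxE; apply: mpoly_eq0_meval => v.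
  have /(congr1 (fun M : 'cV_n => M l 0)) :=
    q0 (\col_i v (lshift k i)) (\col_j v (rshift m j)).
  rewrite !mxE => E; apply: etrans E; apply: meval_eq => s.
  by case: (split_ordP s) => i ->; rewrite ?col_mxEu ?col_mxEd mxE.
congr pair; apply: zero => z w.
  by apply: etrans (fE z w) _; rewrite p4_0 p2_0 b0 !addr0.
by rewrite gE b0 formF0r scaler0.
Qed.

End Vanishing.

Theorem proposition6p6 (R : realType) (m k : nat)
    (A : 'I_k -> 'M[Cplx R]_m)
    (hermA : hermitian_form A)
    (ndA : nondegenerate_form A)
    (DndA : Dnondegenerate A) :
  Tnondegenerate A /\ g_ A 3 = [set (0, 0)]%classic.
Proof.
split; first exact: Dnondegenerate_Tnondegenerate.
exact: Dnondegenerate_g3_eq0.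
Qed.
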